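(* Let $\kappa$ be a regular uncountable cardinal and $\alpha\le\kappa^+$. The function $\mathrm{crk}$ is a rank function on $\mathbb{S}_\alpha$ with $h_{\mathrm{crk}}(\beta)=\beta+\kappa$. In fact, if $\beta<\alpha$, then for every $p\in\mathbb{S}_\alpha$ the condition $q=\pi(p,\beta)$ witnesses the rank-function property for $p$ and $\beta$: $q\parallel p$, $\mathrm{crk}(q)<\beta+\kappa$, and every $r\in\mathbb{S}_\alpha$ with $\mathrm{crk}(r)<\beta$ and $r\parallel q$ satisfies $r\parallel p$.
   Context: Forcing is downwards; $\parallel$ means compatible. A function $\mathrm{crk}:\mathbb{P}\to\mathrm{Ord}\cup\{\infty\}$ is a rank function with strictly increasing witness $h$ if for every $p$ and ordinal $\beta$ there is $q\parallel p$ with $\mathrm{crk}(q)<h(\beta)$ such that every $r$ with $\mathrm{crk}(r)<\beta$ and $r\parallel q$ satisfies $r\parallel p$. For a tree, $\mathrm{succ}(\eta)$ is the set of immediate successors. $\mathbb{S}_\alpha$ consists of triples $p=\langle t_p,\rho_p,\bar\rho_p\rangle$ with $t_p\subseteq{}^{<\omega}\kappa$ a well-founded tree of size $<\kappa$; $\rho_p,\bar\rho_p$ partial functions $t_p\to\alpha$ with disjoint domains whose union is $t_p$; and for all $\nu\in\mathrm{succ}(\eta)$ in $t_p$ one of: $\{\nu,\eta\}\subseteq\mathrm{dom}(\rho_p)$ and $\rho_p(\nu)<\rho_p(\eta)$; $\{\nu,\eta\}\subseteq\mathrm{dom}(\bar\rho_p)$ and $\bar\rho_p(\nu)<\bar\rho_p(\eta)$;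 $\nu\in\mathrm{dom}(\rho_p)$, $\eta\in\mathrm{dom}(\bar\rho_p)$ and $\rho_p(\nu)<\bar\rho_p(\eta)$. Order: $q\le p$ iff $t_p\subseteq t_q$, $\rho_p\subseteq\rho_q$, and for each $\eta\in\mathrm{dom}(\bar\rho_p)$ either $\eta\in\mathrm{dom}(\bar\rho_q)$ and $\bar\rho_q(\eta)\ge\bar\rho_p(\eta)$, or $\eta\in\mathrm{dom}(\rho_q)$ and $\rho_q(\eta)\ge\bar\rho_p(\eta)$. $\mathrm{crk}(p)$ is the supremum of all values of $\rho_p$ and of $\bar\rho_p$. For an ordinal $\beta$, $\pi(p,\beta)=\langle t_p,\rho',\bar\rho'\rangle$ where $\rho'=\rho_p\restriction\{\eta\in\mathrm{dom}(\rho_p):\rho_p(\eta)<\beta\}$ and, for $\eta\in t_p\setminus\mathrm{dom}(\rho')$ (defined recursively from the leaves upward), $\bar\rho'(\eta)=\bar\rho_p(\eta)$ if $\eta\in\mathrm{dom}(\bar\rho_p)$ and $\bar\rho_p(\eta)<\beta$, and otherwise $\bar\rho'(\eta)=\max(\beta,\sup\{\sigma(\nu)+1:\nu\in\mathrm{succ}(\eta)\})$ where $\sigma(\nu)=\rho'(\nu)$ if $\nu\in\mathrm{dom}(\rho')$ and $\sigma(\nu)=\bar\rho'(\nu)$ otherwise.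
   Formalization: The witness h(β)=β+κ is not strictly increasing (0+κ=1+κ), so the formal theorem asserts that it is non-decreasing and has the full witness property, and separately that crk has some strictly increasing witness; the ''in fact'' clause is unchanged. *)

(* Defs.v *)
From HB Require Import structures.
From mathcomp Require Import all_boot all_order.
From mathcomp Require Import generic_quotient.
From mathcomp Require Import boolp classical_sets functions cardinality.

Set Implicit Arguments.
Unset Strict Implicit.
Unset Printing Implicit Defensive.

Import Order.TTheory.
Local Open Scope quotient_scope.
Local Open Scope classical_set_scope.
Local Open Scope order_scope.
Local Open Scope card_scope.

(* Ordinals.  [OLim f] denotes the least ordinal strictly above every [f i];
   as the index type ranges over a universe, each small family of ordinals has
   a strict upper bound (lemma [ord_small_bounded]).  Quotienting by mutual
   comparison gives ordinals with Leibniz equality. *)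
Inductive otree : Type := OLim (I : Type) (f : I -> otree).

Fixpoint otree_le (x y : otree) {struct x} : Prop :=
  match x, y with
  | OLim A f, OLim B g => forall i, exists j, otree_le (f i) (g j)
  end.

Lemma otree_le_refl x : otree_le x x.
Proof. by elim: x => I f IH /= i; exists i; apply: IH. Qed.

Lemma otree_le_trans y x z : otree_le x y -> otree_le y z -> otree_le x z.
Proof.
elim: y x z => J g IH [I f] [K h] /= xy yz i.
have [j fg] := xy i; have [k gh] := yz j.
by exists k; apply: IH fg gh.
Qed.

Lemma otree_le_total x y : otree_le x y \/ otree_le y x.
Proof.
elim: x y => I f IH [J g] /=.
have [?|] := pselect (forall i, exists j, otree_le (f i) (g j)); first by left.
move=> /existsNP[i /forallNP fg]; right => j; exists i.
by have [/fg|] := IH i (g j).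
Qed.

Definition otree_eqv (x y : otree) : bool :=
  `[< otree_le x y /\ otree_le y x >].

Lemma otree_eqv_refl : reflexive otree_eqv.
Proof. by move=> x; apply/asboolP; split; apply: otree_le_refl. Qed.

Lemma otree_eqv_sym : symmetric otree_eqv.
Proof. by move=> x y; apply/asboolP/asboolP => -[]. Qed.

Lemma otree_eqv_trans : transitive otree_eqv.
Proof.
move=> y x z /asboolP[xy yx] /asboolP[yz zy]; apply/asboolP.
by split; apply: (@otree_le_trans y).
Qed.

HB.instance Definition _ := gen_eqMixin otree.
HB.instance Definition _ := gen_choiceMixin otree.

Canonical otree_equiv :=
  EquivRel otree_eqv otree_eqv_refl otree_eqv_sym otree_eqv_trans.

Definition Ord := {eq_quot otree_equiv}.
HB.instance Definition _ := Choice.on Ord.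

Definition ord_le (x y : Ord) : bool := `[< otree_le (repr x) (repr y) >].

Fact ord_le_refl : reflexive ord_le.
Proof. by move=> x; apply/asboolP/otree_le_refl. Qed.

Fact ord_le_anti : antisymmetric ord_le.
Proof.
move=> x y /andP[/asboolP xy /asboolP yx].
by rewrite -[x]reprK -[y]reprK; apply/eqmodP/asboolP.
Qed.

Fact ord_le_trans : transitive ord_le.
Proof.
by move=> y x z /asboolP xy /asboolP yz; apply/asboolP/(otree_le_trans xy).
Qed.

Fact ord_le_total : total ord_le.
Proof.
by move=> x y; apply/orP; case: (otree_le_total (repr x) (repr y)) => ?;
  [left|right]; apply/asboolP.
Qed.

Fact ord_display : Order.disp_t. Proof. exact: Order.Disp tt tt. Qed.

HB.instance Definition _ := Order.Le_isPOrder.Build ord_display Ord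
  ord_le_refl ord_le_anti ord_le_trans.
HB.instance Definition _ :=
  Order.POrder_isTotal.Build ord_display Ord ord_le_total.

Definition oclass (s : otree) : Ord := \pi_Ord s.

Lemma oclassK (x : Ord) : oclass (repr x) = x.
Proof. exact: reprK. Qed.

Lemma ord_leE (x y : Ord) : (x <= y) = `[< otree_le (repr x) (repr y) >].
Proof. by []. Qed.

Lemma oclass_leE (s t : otree) :
  (oclass s <= oclass t) = `[< otree_le s t >].
Proof.
have eqv u : otree_le (repr (oclass u)) u /\ otree_le u (repr (oclass u)).
  have /eqmodP/asboolP[] : repr (oclass u) = u %[mod Ord] by rewrite /oclass reprK.
  by [].
have [[s1 s2] [t1 t2]] := (eqv s, eqv t).
rewrite ord_leE; apply/asboolP/asboolP => H.
  exact: (otree_le_trans s2 (otree_le_trans H t1)).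
exact: (otree_le_trans s1 (otree_le_trans H t2)).
Qed.

Lemma oclass_OLim_lt I (f : I -> otree) i : oclass (f i) < oclass (OLim f).
Proof.
suff H t : forall I (f : I -> otree) i, otree_le t (f i) ->
    ~ otree_le (OLim f) t.
  rewrite ltNge oclass_leE; apply/asboolP; apply: (H (f i) _ _ i).
  exact: otree_le_refl.
elim: t => J g IH K h k /= kg /(_ k)[j hg].
case E : (h k) kg hg => [L l] kg hg.
have [m gm] := kg j.
by apply: (IH j L l m gm hg).
Qed.

Lemma lt_oclass_OLim I (f : I -> otree) (x : Ord) :
  x < oclass (OLim f) -> exists i, x <= oclass (f i).
Proof.
have H s t : ~ otree_le s t ->
    match s with OLim A f => exists i, otree_le t (f i) end.
  elim: s t => {I f} I f IH [J g] /= /existsNP[i /forallNP fg].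
  exists i; case E : (f i) => [K h] j /=.
  by have := IH i (g j) (fg j); rewrite E.
rewrite -[x]oclassK ltNge oclass_leE => /asboolP/H[i xf].
by exists i; rewrite oclass_leE; apply/asboolP.
Qed.

Lemma ord_wf : well_founded (fun x y : Ord => x < y).
Proof.
move=> x; rewrite -[x]oclassK; elim: (repr x) => {x} I f IH.
constructor=> x /lt_oclass_OLim[i]; rewrite le_eqVlt => /predU1P[->|].
  exact: IH.
exact: Acc_inv (IH i) _.
Qed.

Lemma ord_small_bounded (I : Type) (f : I -> Ord) :
  exists x, forall i, f i < x.
Proof.
exists (oclass (OLim (fun i => repr (f i)))) => i.
by rewrite -{1}[f i]oclassK oclass_OLim_lt.
Qed.

Lemma ord_segment_small (x : Ord) :
  exists (I : Type) (f : I -> Ord), forall y, y < x -> exists i, y = f i.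
Proof.
rewrite -[x]oclassK; elim: (repr x) => {x} I f IH.
have /choice[F HF] : forall i, exists F : {J : Type & J -> Ord},
    forall y, y < oclass (f i) -> exists j, y = projT2 F j.
  by move=> i; have [J [g Hg]] := IH i; exists (existT _ J g).
exists {i : I & option (projT1 (F i))}.
exists (fun u => if projT2 u is Some j then projT2 (F (projT1 u)) j
                 else oclass (f (projT1 u))).
move=> y /lt_oclass_OLim[i]; rewrite le_eqVlt => /predU1P[->|/HF[j ->]].
  by exists (existT _ i None).
by exists (existT _ i (Some j)).
Qed.

Lemma ord_replacement (x : Ord) (f : Ord -> Ord) :
  exists y, forall z, z < x -> f z < y.
Proof.
have [I [g gP]] := ord_segment_small x.
have [y yP] := ord_small_bounded (f \o g).
by exists y => z /gP[i ->]; apply: yP.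
Qed.

Definition ozero : Ord := oclass (OLim (False_rect otree)).

HB.instance Definition _ := isPointed.Build Ord ozero.

Lemma ozero_le x : ozero <= x.
Proof.
rewrite -[x]oclassK oclass_leE; apply/asboolP.
by case: (repr x) => J g [].
Qed.

(* Only used for nonempty [A] (resp. for bounded [A], with supremum of the
   empty set equal to [ozero]); see [leastP] and [osupP]. *)
Definition least (A : set Ord) : Ord := xget ozero (A `&` lbound A).
Definition osup (A : set Ord) : Ord := supremum ozero A.

Lemma leastP (A : set Ord) : A !=set0 -> (A `&` lbound A) (least A).
Proof.
move=> [x Ax]; rewrite /least; case: xgetP => [//|noA]; exfalso.
elim/(well_founded_ind ord_wf): x Ax => x IH Ax.
apply: (noA x); split=> // y Ay; rewrite leNgt; apply/negP => yx.
exact: IH yx Ay.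
Qed.

Lemma osupP (A : set Ord) : has_ubound A -> supremums A (osup A).
Proof.
move=> /leastP[Hu Hl]; rewrite /osup /supremum.
case: eqP => [->|_].
  by split=> [x []|x _]; apply: ozero_le.
by case: xgetP => [//|/(_ (least (ubound A)))] [].
Qed.

Definition osucc (x : Ord) : Ord := least [set y | x < y].

Definition oadd (x : Ord) : Ord -> Ord :=
  Fix ord_wf (fun=> Ord) (fun y rec =>
    Order.max x (osup [set z | exists u (uy : u < y), z = osucc (rec u uy)])).

Notation "x +o y" := (oadd x y) (at level 50, left associativity) : order_scope.

Lemma oaddE x y :
  x +o y = Order.max x (osup [set osucc (x +o u) | u in [set u | u < y]]).
Proof.
rewrite {1}/oadd Fix_eq => [|{}y f g fg].
  congr (Order.max x (osup _)); apply/seteqP; split=> z /=.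
    by move=> [u [uy ->]]; exists u.
  by move=> [u uy <-]; exists u, uy.
by congr (Order.max x (osup _)); apply/seteqP; split=> z [u [uy ->]];
  exists u, uy; rewrite fg.
Qed.

Definition segment (x : Ord) : set Ord := [set y | y < x].

Definition is_cardinal (k : Ord) : Prop :=
  forall x, x < k -> ~~ (segment k #<= segment x).

Definition card_succ (k : Ord) : Ord :=
  least [set m | is_cardinal m /\ k < m].

Definition cofinality (k : Ord) : Ord :=
  least [set l | exists f : Ord -> Ord,
    (forall x, x < l -> f x < k) /\
    (forall y, y < k -> exists2 x, x < l & y <= f x)].

Definition regular_uncountable (k : Ord) : Prop :=
  [/\ is_cardinal k, cofinality k = k & ~~ countable (segment k)].

Lemma ord_hartogs (k : Ord) : exists m, ~~ (segment m #<= segment k).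
Proof.
have [I [g gP]] := ord_segment_small k.
pose rk (R : {R : I -> I -> Prop | well_founded R}) : I -> Ord :=
  Fix (proj2_sig R) (fun=> Ord) (fun i rec =>
    oclass (OLim (fun u : {j | proj1_sig R j i} =>
                    repr (rec (proj1_sig u) (proj2_sig u))))).
have rkE R i : rk R i =
    oclass (OLim (fun u : {j | proj1_sig R j i} => repr (rk R (proj1_sig u)))).
  rewrite {1}/rk Fix_eq => [//|{}i f1 f2 f12].
  by congr (oclass (OLim _)); apply/funext => u; rewrite f12.
pose T R := oclass (OLim (fun i => repr (rk R i))).
have [m mP] := ord_small_bounded T.
exists m; apply/negP => mk.
have /injfunPex[F Ffun Finj] := pcard_leP mk.
have FP x : x < m -> exists i, F x = g i.
  by move=> xm; have [i ->] := gP _ (Ffun x xm); exists i.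
pose R i j := exists x y, [/\ x < y, y < m, F x = g i & F y = g j].
have Rwf : well_founded R.
  suff H y i : y < m -> F y = g i -> Acc R i.
    by move=> j; constructor=> i [x [y [xy ym Fx _]]];
      apply: (H x) => //; apply: lt_trans xy ym.
  elim/(well_founded_ind ord_wf): y i => y IH i ym Fy.
  constructor=> j [x [z [xz zm Fx Fz]]].
  have zy : z = y.
    by apply: Finj; rewrite ?inE ?Fz.
  by apply: (IH x) => //; [rewrite -zy|apply: lt_trans xz zm].
pose R' : {R : I -> I -> Prop | well_founded R} := exist _ R Rwf.
have le_rk y i : y < m -> F y = g i -> y <= rk R' i.
  elim/(well_founded_ind ord_wf): y i => y IH i ym Fy.
  rewrite leNgt; apply/negP => lt_y.
  have xm : rk R' i < m by apply: lt_trans lt_y ym.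
  have [j Fj] := FP _ xm.
  have Rji : proj1_sig R' j i by exists (rk R' i), y.
  have := IH _ lt_y j xm Fj; rewrite leNgt => /negP; apply.
  rewrite [ltRHS]rkE.
  have := oclass_OLim_lt (fun u : {j | proj1_sig R' j i} =>
                            repr (rk R' (proj1_sig u))) (exist _ j Rji).
  by rewrite oclassK.
have Tm := mP R'.
have [i Fi] := FP _ Tm.
have := le_rk _ _ Tm Fi; rewrite leNgt => /negP; apply.
by have := oclass_OLim_lt (fun i => repr (rk R' i)) i; rewrite oclassK.
Qed.

Lemma card_succP (k : Ord) : is_cardinal (card_succ k) /\ k < card_succ k.
Proof.
suff /leastP[] : [set m | is_cardinal m /\ k < m] !=set0 by [].
have /leastP[/= Hm Hl] : [set m | ~~ (segment m #<= segment k)] !=set0.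
  exact: ord_hartogs.
exists (least [set m | ~~ (segment m #<= segment k)]); split.
  move=> x xm; apply/negP => mx; move/negP: Hm; apply.
  apply: card_le_trans mx _; apply: contrapT => /negP /Hl.
  by rewrite leNgt xm.
rewrite ltNge; apply/negP => mk; move/negP: Hm; apply.
by apply: subset_card_le => y /= ym; apply: lt_le_trans ym mk.
Qed.

(* Extended ordinals are [option Ord], with [None] standing for infinity. *)
Definition xlt (x : option Ord) (b : Ord) : Prop :=
  if x is Some a then a < b else False.

Section Forcing.
Variables (P : Type) (stronger : P -> P -> Prop).

Definition compatible (p q : P) : Prop :=
  exists r, stronger r p /\ stronger r q.

Definition rank_reduct (crk : P -> option Ord) (h : Ord -> Ord)
    (p : P) (b : Ord) (q : P) : Prop :=
  [/\ compatible q p,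
      xlt (crk q) (h b) &
      forall r, xlt (crk r) b -> compatible r q -> compatible r p].

Definition rank_witness (crk : P -> option Ord) (h : Ord -> Ord) : Prop :=
  forall p b, exists q, rank_reduct crk h p b q.

(* For infinite [k] the map [b |-> b +o k] is monotone but not strictly so
   ([1 +o k = 0 +o k]), hence the separation of [rank_witness] from strict
   monotonicity of the witness. *)
Definition rank_function (crk : P -> option Ord) : Prop :=
  exists h : Ord -> Ord, {homo h : x y / x < y} /\ rank_witness crk h.

End Forcing.

Definition node := seq Ord.

Definition child (nu eta : node) : Prop := exists x, nu = rcons eta x.

Definition succ_in (t : set node) (nu eta : node) : Prop :=
  [/\ t nu, t eta & child nu eta].

(* Trees are closed under initial segments, so immediate successors are the
   one-step extensions; the empty tree is allowed. *)
Definition is_tree (k : Ord) (t : set node) : Prop :=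
  (forall eta, t eta -> all (fun x => x < k) eta) /\
  (forall eta x, t (rcons eta x) -> t eta).

Record triple := Triple {
  tree_of : set node;
  rho : node -> option Ord;
  rhobar : node -> option Ord }.

Definition below (k : Ord) (t : set node) : Prop :=
  (t #<= segment k) && ~~ (segment k #<= t).

Record in_S (k a : Ord) (p : triple) : Prop := InS {
  S_tree : is_tree k (tree_of p);
  S_wf : well_founded (succ_in (tree_of p));
  S_small : below k (tree_of p);
  S_rho_lt : forall eta x, rho p eta = Some x -> x < a;
  S_rhobar_lt : forall eta x, rhobar p eta = Some x -> x < a;
  S_disjoint : forall eta, ~ (rho p eta /\ rhobar p eta);
  S_cover : forall eta, tree_of p eta <-> rho p eta \/ rhobar p eta;
  S_succ : forall nu eta, succ_in (tree_of p) nu eta ->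
    [\/ exists x y, [/\ rho p nu = Some x, rho p eta = Some y & x < y],
        exists x y, [/\ rhobar p nu = Some x, rhobar p eta = Some y & x < y] |
        exists x y, [/\ rho p nu = Some x, rhobar p eta = Some y & x < y]] }.

Definition forcing_S (k a : Ord) := {p : triple | in_S k a p}.

Definition triple_of k a (p : forcing_S k a) : triple := proj1_sig p.
Coercion triple_of : forcing_S >-> triple.

Definition extends (q p : triple) : Prop :=
  [/\ tree_of p `<=` tree_of q,
      forall eta x, rho p eta = Some x -> rho q eta = Some x &
      forall eta x, rhobar p eta = Some x ->
        (exists2 y, rhobar q eta = Some y & x <= y) \/
        (exists2 y, rho q eta = Some y & x <= y)].

Definition stronger_S (k a : Ord) (q p : forcing_S k a) : Prop := extends q p.

Definition crk (p : triple) : Ord :=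
  osup [set x | exists eta, rho p eta = Some x \/ rhobar p eta = Some x].

Definition crk_S (k a : Ord) (p : forcing_S k a) : option Ord := Some (crk p).

Definition cut (b : Ord) (x : option Ord) : option Ord :=
  if x is Some y then if y < b then Some y else None else None.

(* [pi_val p b eta] is the value at [eta] of whichever of the two functions of
   the projected triple is defined there, i.e. the auxiliary function sigma. *)
Definition pi_val k a (p : forcing_S k a) (b : Ord) : node -> Ord :=
  Fix (S_wf (proj2_sig p)) (fun=> Ord) (fun eta rec =>
    if cut b (rho p eta) is Some x then x else
    if cut b (rhobar p eta) is Some x then x else
    Order.max b (osup [set z | exists nu (nu_eta : succ_in (tree_of p) nu eta),
                               z = osucc (rec nu nu_eta)])).

Definition pi_proj k a (p : forcing_S k a) (b : Ord) : triple :=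
  Triple (tree_of p)
    (fun eta => cut b (rho p eta))
    (fun eta => if `[< tree_of p eta >] && ~~ cut b (rho p eta)
                then Some (pi_val p b eta) else None).

Lemma pi_valE k a (p : forcing_S k a) (b : Ord) eta :
  pi_val p b eta =
    if cut b (rho p eta) is Some x then x else
    if cut b (rhobar p eta) is Some x then x else
    Order.max b (osup [set osucc (pi_val p b nu) |
                         nu in [set nu | succ_in (tree_of p) nu eta]]).
Proof.
rewrite {1}/pi_val Fix_eq => [|{}eta f g fg].
  case: (cut b (rho p eta)) => [//|]; case: (cut b (rhobar p eta)) => [//|].
  congr (Order.max b (osup _)); apply/seteqP; split=> z /=.
    by move=> [nu [H ->]]; exists nu.
  by move=> [nu H <-]; exists nu, H.
case: (cut b (rho p eta)) => [//|]; case: (cut b (rhobar p eta)) => [//|].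
by congr (Order.max b (osup _)); apply/seteqP; split=> z [nu [H ->]];
  exists nu, H; rewrite fg.
Qed.

(* Main.v *)
(** The projection [pi_proj p b] is weaker than [p], and its values stay below
    [b +o kappa] because by regularity the values climb above [b] by fewer than
    [kappa] steps along a well-founded tree of size less than [kappa].

    Suppose [s] extends both [r] and [pi_proj p b], where [crk r < b].  On the
    union of the trees of [p] and [r], let [w] be the pointwise maximum of the
    values of [p] and [r] (0 where undefined).  Declaring all of [w] to be
    [rho] gives a condition, as [w] decreases strictly along the tree.  It
    extends [p] and [r] provided that the maximum never exceeds a value fixed
    by [rho p] or [rho r].  Values of [p] that are at least [b] dominate [r];
    below [b], [p] and its projection agree, so [s] settles the comparison. *)
Require Import Defs.
From mathcomp Require Import all_boot all_order.
From mathcomp Require Import boolp classical_sets cardinality.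

Set Implicit Arguments.
Unset Strict Implicit.
Unset Printing Implicit Defensive.

Import Order.TTheory.
Local Open Scope order_scope.
Local Open Scope card_scope.
Local Open Scope classical_set_scope.

(** * Ordinal successor, suprema and addition *)

Lemma lt_osucc x : x < osucc x.
Proof.
have [y yP] := ord_small_bounded (fun _ : unit => x).
by have [] : ([set y | x < y] `&` lbound [set y | x < y]) (osucc x);
  [apply: leastP; exists y; apply: yP tt | ].
Qed.

Lemma osucc_le x y : (osucc x <= y) = (x < y).
Proof.
apply/idP/idP => [|xy]; first exact/lt_le_trans/lt_osucc.
by have [_] : ([set y | x < y] `&` lbound [set y | x < y]) (osucc x);
  [apply: leastP; exists y | apply].
Qed.

Lemma osup_ub (A : set Ord) x : has_ubound A -> A x -> x <= osup A.
Proof. by move=> /osupP[+ _] Ax; apply. Qed.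

Lemma osup_le (A : set Ord) b : ubound A b -> osup A <= b.
Proof.
move=> Ab; have [|_] := @osupP A; first by exists b.
exact.
Qed.

(** Replacement bounds the set in the recursion for [+o], so its [osup] is a true supremum. The
    monotonicity laws below all come from this characterization. *)
Lemma oadd_le_max x y z :
  (x +o y <= z) <-> (x <= z /\ forall u, u < y -> x +o u < z).
Proof.
have ub : has_ubound [set osucc (x +o u) | u in [set u | u < y]].
  have [v vP] := ord_replacement y (fun u => osucc (x +o u)).
  by exists v => _ [u uy <-]; apply/ltW/vP.
rewrite oaddE ge_max; split=> [/andP[-> yz]|[-> yz]].
  split=> // u uy; rewrite -osucc_le; apply: le_trans yz.
  by apply: osup_ub => //; exists u.
by apply: osup_le => _ [u uy <-]; rewrite osucc_le yz.
Qed.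

Lemma le_oadd x y : x <= x +o y.
Proof. by have /oadd_le_max[] := lexx (x +o y). Qed.

Lemma ltr_oadd x y z : y < z -> x +o y < x +o z.
Proof. by have /oadd_le_max[_ /(_ y)] := lexx (x +o z). Qed.

Lemma lel_oadd x y z : x <= y -> x +o z <= y +o z.
Proof.
move=> xy; elim/(well_founded_ind ord_wf): z => z IH.
apply/oadd_le_max; split=> [|u uz]; first exact/(le_trans xy)/le_oadd.
exact/(le_lt_trans (IH u uz))/ltr_oadd.
Qed.

(** * Regularity: small families of ordinals below [k] are bounded *)

Lemma cofinality_bounded k l (f : Ord -> Ord) : cofinality k = k -> l < k ->
  (forall x, x < l -> f x < k) ->
  exists2 y, y < k & forall x, x < l -> f x < y.
Proof.
move=> kk lk fk; apply: contrapT => nob.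
pose C := [set l | exists f : Ord -> Ord, (forall x, x < l -> f x < k) /\
    (forall y, y < k -> exists2 x, x < l & y <= f x)].
(* An unbounded [f] would make [l] the length of a cofinal map into [k], but the least such length
   is [k]. *)
have Cl : C l.
  exists f; split=> // y yk; apply: contrapT => noy; apply: nob.
  exists y => // x xl; rewrite ltNge; apply/negP => yx.
  by apply: noy; exists x.
have [] : (C `&` lbound C) (cofinality k) by apply: leastP; exists l.
by rewrite kk => _ /(_ l Cl); rewrite leNgt lk.
Qed.

(* An unbounded image would have order type [k]: [e] enumerates preimages of a
   cofinal increasing [k]-sequence. *)
Lemma small_bounded (T : choiceType) k (A : set T) (f : T -> Ord) :
  cofinality k = k -> ~~ (segment k #<= A) -> (forall a, A a -> f a < k) ->
  exists2 y, y < k & forall a, A a -> f a < y.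
Proof.
move=> kk kA fk; apply: contrapT => nob.
have large y : y < k -> exists2 a, A a & y <= f a.
  move=> yk; apply: contrapT => noa; apply: nob; exists y => // a Aa.
  by rewrite ltNge; apply/negP => ya; apply: noa; exists a.
(* The recursion below needs a default in [T]; an element of [A] supplies it once [k] is nonzero. *)
have [k0|k0] := pselect (exists y, y < k); last first.
  move/negP: kA; apply; suff -> : segment k = set0 by apply: card_ge0.
  by rewrite -subset0 => x xk; apply: k0; exists x.
have {k0} [t0 _] : exists t0 : T, True.
  by have [y /large[a _ _]] := k0; exists a.
pose Q (x : Ord) (g : forall z, z < x -> T) :=
  [set a | A a /\ forall z (zx : z < x), f (g z zx) < f a].
pose e := Fix ord_wf (fun=> T) (fun x g => xget t0 (Q x g)).
have eE x : e x = xget t0 [set a | A a /\ forall z, z < x -> f (e z) < f a].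
  by rewrite {1}/e Fix_eq // => {}x g h gh; congr (xget t0 (Q x _));
    do 2![apply: functional_extensionality_dep => ?].
have eP x : x < k -> A (e x) /\ forall z, z < x -> f (e z) < f (e x).
  elim/(well_founded_ind ord_wf): x => x IH xk; rewrite [e x]eE.
  (* For [x < k] the choice of [e x] never falls back on [t0]: regularity bounds the earlier values
     [f (e z)] by some [y < k], and [large] gives an element of [A] with value at least [y]. *)
  have [|y yk yP] := @cofinality_bounded k x (f \o e) kk xk.
    by move=> z zx; apply/fk; have [] := IH z zx (lt_trans zx xk).
  have [a Aa ya] := large y yk.
  case: xgetP => [b -> //|/(_ a)[]]; split=> // z zx.
  exact: lt_le_trans (yP z zx) ya.
move/negP: kA; apply.
have einj : {in segment k &, injective e}.
  move=> x y /set_mem xk /set_mem yk exy; case: (ltgtP x y) => // [xy|yx].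
    by have [_ /(_ x xy)] := eP y yk; rewrite exy ltxx.
  by have [_ /(_ y yx)] := eP x xk; rewrite exy ltxx.
have /card_eqPle[_ ke] := inj_card_eq einj.
apply: card_le_trans ke _; apply: subset_card_le => _ [x xk <-].
by have [] := eP x xk.
Qed.

(** * Values and rank of a condition *)

Definition value (p : triple) (eta : node) : Ord :=
  if rho p eta is Some x then x else odflt ozero (rhobar p eta).

Lemma value_rho p eta x : rho p eta = Some x -> value p eta = x.
Proof. by rewrite /value => ->. Qed.

Section Condition.
Variables (k a : Ord) (p : triple).
Hypothesis Sp : in_S k a p.

Lemma rhobar_rho eta x : rhobar p eta = Some x -> rho p eta = None.
Proof.
move=> bx; have := S_disjoint Sp (eta := eta); rewrite bx.
by case: (rho p eta) => // y [].
Qed.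

Lemma value_rhobar eta x : rhobar p eta = Some x -> value p eta = x.
Proof. by move=> bx; rewrite /value (rhobar_rho bx) bx. Qed.

Lemma rho_tree eta x : rho p eta = Some x -> tree_of p eta.
Proof. by move=> rx; apply/(S_cover Sp); rewrite rx; left. Qed.

Lemma rhobar_tree eta x : rhobar p eta = Some x -> tree_of p eta.
Proof. by move=> rx; apply/(S_cover Sp); rewrite rx; right. Qed.

Lemma treeP eta : tree_of p eta ->
  rho p eta = Some (value p eta) \/ rhobar p eta = Some (value p eta).
Proof.
rewrite /value => /(S_cover Sp).
by case: (rho p eta) (rhobar p eta) => [x|] [y|] /= []; by [left|right].
Qed.

(** Zero being the least ordinal, a pointwise maximum ignores a condition at nodes outside its
    tree. *)
Lemma value_out eta : ~ tree_of p eta -> value p eta = ozero.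
Proof.
rewrite /value => nt.
case rx : (rho p eta) => [x|]; first by have := rho_tree rx.
by case bx : (rhobar p eta) => [x|//]; have := rhobar_tree bx.
Qed.

Lemma value_lt eta : tree_of p eta -> value p eta < a.
Proof. by move=> /treeP[/(S_rho_lt Sp)|/(S_rhobar_lt Sp)]. Qed.

Lemma value_succ nu eta :
  succ_in (tree_of p) nu eta -> value p nu < value p eta.
Proof.
case/(S_succ Sp) => -[x [y []]].
- by move=> /value_rho-> /value_rho->.
- by move=> /value_rhobar-> /value_rhobar->.
- by move=> /value_rho-> /value_rhobar->.
Qed.

Lemma crk_ub :
  has_ubound [set x | exists eta, rho p eta = Some x \/ rhobar p eta = Some x].
Proof.
exists a => x [eta [rx|bx]]; apply: ltW.
  exact: S_rho_lt Sp _ _ rx.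
exact: S_rhobar_lt Sp _ _ bx.
Qed.

Lemma value_le_crk eta : tree_of p eta -> value p eta <= crk p.
Proof. by move=> /treeP ?; apply: osup_ub crk_ub _; exists eta. Qed.

Lemma crk_le b :
  (forall eta, tree_of p eta -> value p eta <= b) -> crk p <= b.
Proof.
move=> pb; apply: osup_le => x [eta [rx|bx]].
  by rewrite -(value_rho rx); apply/pb/(rho_tree rx).
by rewrite -(value_rhobar bx); apply/pb/(rhobar_tree bx).
Qed.

End Condition.

(** A [rho] value is frozen, while a [rhobar] value can only grow, even when it turns into a [rho]
    value. *)
Lemma value_extends k a p q eta : in_S k a p -> in_S k a q -> extends q p ->
  tree_of p eta -> value p eta <= value q eta.
Proof.
move=> Sp Sq [_ qr qb] /(treeP Sp)[/qr/value_rho->//|/qb[] [y qy py]].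
  by rewrite (value_rhobar Sq qy).
by rewrite (value_rho qy).
Qed.

Lemma succ_wf_sub (t t' : set node) : t `<=` t' ->
  well_founded (succ_in t') -> well_founded (succ_in t).
Proof.
move=> tt' wf eta; elim/(well_founded_ind wf): eta => eta IH.
by constructor=> nu [/tt' tnu /tt' teta ch]; apply: IH.
Qed.

Lemma below_sub k (t t' : set node) : t `<=` t' -> below k t' -> below k t.
Proof.
move=> /subset_card_le tt' /andP[tk kt]; apply/andP; split.
  exact: card_le_trans tt' tk.
by apply: contra kt => kt; apply: card_le_trans kt tt'.
Qed.

(** * The projected condition and its rank *)

Section Projection.
Variables (k a : Ord) (p : forcing_S k a) (b : Ord).
Let Sp : in_S k a p := proj2_sig p.
Let t := tree_of p.

Lemma cut_some o x : cut b o = Some x -> o = Some x /\ x < b.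
Proof. by case: o => //= y; case: ifP => // yb [<-]. Qed.

Lemma pi_val_small eta : t eta -> value p eta < b -> pi_val p b eta = value p eta.
Proof.
move=> te vb; rewrite pi_valE.
case: (treeP Sp te) => e; first by rewrite e /= vb.
by rewrite (rhobar_rho Sp e) e /= vb.
Qed.

Lemma pi_val_large eta : t eta -> b <= value p eta ->
  pi_val p b eta = Order.max b
    (osup [set osucc (pi_val p b nu) | nu in [set nu | succ_in t nu eta]]).
Proof.
move=> te; rewrite leNgt => /negbTE vb; rewrite pi_valE.
case: (treeP Sp te) => e; last by rewrite (rhobar_rho Sp e) e /= vb.
by rewrite e /= vb; case: (rhobar p eta) (S_disjoint Sp (eta := eta));
  rewrite e // => x [].
Qed.

(** Induction from the leaves: a value of [p] that is at least [b] also exceeds the values of [p] at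
    the successors, hence bounds everything that enters the maximum. *)
Lemma pi_val_le eta : t eta -> pi_val p b eta <= value p eta.
Proof.
elim/(well_founded_ind (S_wf Sp)): eta => eta IH te.
case: (ltP (value p eta) b) => [/pi_val_small->//|vb].
rewrite pi_val_large // ge_max vb; apply: osup_le => _ [nu ne <-].
rewrite osucc_le; apply: le_lt_trans (value_succ Sp ne).
by apply: IH => //; case: ne.
Qed.

Lemma pi_val_succ nu eta : succ_in t nu eta -> pi_val p b nu < pi_val p b eta.
Proof.
move=> ne; have [tn te _] := ne.
case: (ltP (value p eta) b) => [vb|vb].
  rewrite (pi_val_small te vb).
  exact: le_lt_trans (pi_val_le tn) (value_succ Sp ne).
rewrite (pi_val_large te vb) lt_max -[X in _ || X]osucc_le; apply/orP; right.
apply: osup_ub; last by exists nu.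
(* The set under [osup] must be bounded; the value of [p] at [eta] serves. *)
exists (value p eta) => _ [mu me <-]; rewrite osucc_le.
by apply: le_lt_trans (value_succ Sp me); apply: pi_val_le; case: me.
Qed.

Lemma value_pi eta : t eta -> value (pi_proj p b) eta = pi_val p b eta.
Proof.
move=> te; rewrite /value /= asboolT //=.
by rewrite pi_valE; case: (cut b (rho p eta)).
Qed.

Lemma pi_proj_in_S : in_S k a (pi_proj p b).
Proof.
split=> /=.
- exact: S_tree Sp.
- exact: S_wf Sp.
- exact: S_small Sp.
- by move=> eta x /cut_some[/(S_rho_lt Sp)].
- move=> eta x; case: ifP => // /andP[/asboolP te _] [<-].
  exact: le_lt_trans (pi_val_le te) (value_lt Sp te).
- move=> eta; case: (cut b _) => [x|]; last by case.
  by rewrite andbF => -[].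
- move=> eta; case E: (cut b _) => [x|] /=.
    have [/(rho_tree Sp) te _] := cut_some E.
    by split=> // _; left.
  by rewrite andbT; case: asboolP => te; split=> //; [right | case].
- move=> nu eta ne; have [tn te _] := ne; have vne := pi_val_succ ne.
  rewrite !asboolT //=.
  have rE mu x : cut b (rho p mu) = Some x -> pi_val p b mu = x.
    by move=> ex; rewrite pi_valE ex.
  case En: (cut b (rho p nu)) => [x|]; case Ee: (cut b (rho p eta)) => [y|] /=.
  + by constructor 1; exists x, y; rewrite -(rE _ _ En) -(rE _ _ Ee).
  + by constructor 3; exists x, (pi_val p b eta); rewrite -(rE _ _ En).
  (* The pattern not allowed in a condition: a [rho] value below [b] at [eta] forces a smaller [rho]
     value at [nu], which the cut would have kept. *)
  + have [ey yb] := cut_some Ee.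
    case: (S_succ Sp ne) => -[u [v [eu ev uv]]].
    * by move: En uv; rewrite eu ey in ev *; case: ev => <-;
        rewrite /= => + uy; rewrite (lt_trans uy yb).
    * by rewrite (rhobar_rho Sp ev) in ey.
    * by rewrite (rhobar_rho Sp ev) in ey.
  + by constructor 2; exists (pi_val p b nu), (pi_val p b eta).
Qed.

Lemma extends_pi_proj : extends p (pi_proj p b).
Proof.
split=> //= [eta x /cut_some[]//|eta x].
case: ifP => // /andP[/asboolP te _] [<-]; have le_v := pi_val_le te.
by case: (treeP Sp te) => e; [right|left]; exists (value p eta).
Qed.

Lemma crk_pi_proj : regular_uncountable k -> crk (pi_proj p b) < b +o k.
Proof.
move=> rk; have [_ kk _] := rk.
have k_gt0 : ozero < k.
  case: rk => _ _; apply: contraNT; rewrite -leNgt => k0.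
  suff -> : segment k = set0 by apply: countable0.
  by rewrite -subset0 => x xk; have := lt_le_trans xk k0; rewrite ltNge ozero_le.
have kt : ~~ (segment k #<= t) by case/andP: (S_small Sp).
(* Applied to the successors of a node and to the whole tree. The least offsets [g] lie below [k]
   and are indexed by fewer than [k] nodes, so regularity bounds them. *)
have bounded (A : set node) : A `<=` t ->
    (forall eta, A eta -> exists2 g, g < k & pi_val p b eta <= b +o g) ->
    exists2 y, y < k & forall eta, A eta -> pi_val p b eta < b +o y.
  move=> At Ag; pose G eta := [set g | pi_val p b eta <= b +o g].
  have GP eta : A eta -> least (G eta) < k /\ G eta (least (G eta)).
    move=> /Ag[g gk eg]; have [|G1 /(_ g eg) G2] := @leastP (G eta).
      by exists g.
    by split=> //; apply: le_lt_trans G2 gk.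
  have [| |y yk yP] := @small_bounded _ k A (fun eta => least (G eta)) kk.
  - by apply: contra kt => kA; apply: card_le_trans kA (subset_card_le At).
  - by move=> eta /GP[].
  exists y => // eta Aeta; have [_] := GP eta Aeta.
  by move=> /le_lt_trans; apply; apply/ltr_oadd/yP.
have [| |y yk yP] := bounded t; first by [].
  move=> eta; elim/(well_founded_ind (S_wf Sp)): eta => eta IH te.
  case: (ltP (value p eta) b) => [vb|vb].
    exists ozero => //; rewrite (pi_val_small te vb).
    exact: le_trans (ltW vb) (le_oadd _ _).
  (* The bound [b +o y] on the successors is strict, so it absorbs the [osucc] in [pi_val] and the
     offset [y] still works at [eta]. *)
  have [||y yk yP] := bounded [set nu | succ_in t nu eta].
  - by move=> nu [].
  - by move=> nu ne; apply: IH => //; case: ne.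
  exists y => //; rewrite (pi_val_large te vb) ge_max le_oadd.
  by apply: osup_le => _ [nu ne <-]; rewrite osucc_le yP.
apply: le_lt_trans (ltr_oadd b yk); apply: (crk_le pi_proj_in_S) => eta te.
by rewrite value_pi //; apply/ltW/yP.
Qed.

(** * Amalgamation of [p] with a condition of small rank *)

Definition max_union (r : triple) : triple :=
  let t' := t `|` tree_of r in
  Triple t'
    (fun eta => if `[< t' eta >] then Some (Order.max (value p eta) (value r eta))
                else None)
    (fun=> None).

Lemma max_union_in_S_extends (r s : forcing_S k a) : crk r < b ->
  extends s r -> extends s (pi_proj p b) ->
  [/\ in_S k a (max_union r), extends (max_union r) p
    & extends (max_union r) r].
Proof.
move=> rb sr sp; have Sr : in_S k a r := proj2_sig r.
have Ss : in_S k a s := proj2_sig s.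
have rlt eta : tree_of r eta -> value r eta < b.
  by move=> /(value_le_crk Sr)/le_lt_trans; apply.
have [str srr _] := sr; have [stp spr _] := sp.
(* As a subset of the tree of [s], the union inherits well-foundedness and smallness. *)
have sts : t `|` tree_of r `<=` tree_of s by move=> eta [/stp|/str].
have le_rho_p eta x : rho p eta = Some x -> value r eta <= x.
  move=> px; have [tr|/(value_out Sr)->] := pselect (tree_of r eta); last first.
    exact: ozero_le.
  case: (ltP x b) => [xb|]; last exact/le_trans/ltW/rlt.
  (* Below [b] the cut keeps [x], so [s] also has value [x] at [eta], and values of [r] only grow in
     [s]. *)
  have /spr/value_rho <- : rho (pi_proj p b) eta = Some x by rewrite /= px /= xb.
  exact: value_extends Sr Ss sr tr.
have le_rho_r eta x : rho r eta = Some x -> value p eta <= x.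
  move=> rx; have [tp|/(value_out Sp)->] := pselect (t eta); last first.
    exact: ozero_le.
  have xb : x < b by rewrite -(value_rho rx); apply/rlt/(rho_tree Sr rx).
  have := value_extends pi_proj_in_S Ss sp tp.
  rewrite value_pi // (value_rho (srr _ _ rx)).
  case: (ltP (value p eta) b) => [/(pi_val_small tp)->//|].
  (* Otherwise the projected value would be at least [b], yet it is at most the value [x < b] of
     [s]. *)
  move=> /(pi_val_large tp)-> /le_lt_trans/(_ xb).
  by rewrite gt_max ltxx.
have maxE eta : t eta \/ tree_of r eta ->
    rho (max_union r) eta = Some (Order.max (value p eta) (value r eta)).
  by move=> ?; rewrite /= asboolT.
split.
- split=> /=.
  + have [[pk pt] [rk rt]] := (S_tree Sp, S_tree Sr); split.
      by move=> eta [/pk|/rk].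
    by move=> eta x [/pt|/rt]; [left|right].
  + exact: succ_wf_sub sts (S_wf Ss).
  + exact: below_sub sts (S_small Ss).
  + move=> eta x; case: asboolP => // te [<-].
    (* Zero is the value off a tree; it lies below [a] because [eta] has a value in [s]. *)
    have a0 : ozero < a.
      exact: le_lt_trans (ozero_le _) (value_lt Ss (sts _ te)).
    have vlt q : in_S k a q -> value q eta < a.
      move=> Sq; have [tq|nq] := pselect (tree_of q eta).
        exact (value_lt Sq tq).
      by rewrite (value_out Sq nq).
    by rewrite gt_max !vlt.
  + by [].
  + by move=> eta [].
  + by move=> eta; case: asboolP => te; split=> //; [left|case].
  + move=> nu eta [tn te [x nuE]]; constructor 1.
    exists (Order.max (value p nu) (value r nu)).
    exists (Order.max (value p eta) (value r eta)); rewrite !asboolT //.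
    split=> //.
    (* If [nu] is missing from one tree, its value there is zero and the strict decrease comes from
       the other condition. *)
    have step q : in_S k a q ->
        value q nu < value q eta \/ (value q nu = ozero /\ ~ tree_of q nu).
      move=> Sq; have [tq|nq] := pselect (tree_of q nu).
        left; apply: (value_succ Sq); split=> //; last by exists x.
        by have [_ /(_ eta x)] := S_tree Sq; rewrite -nuE => /(_ tq).
      by right; rewrite (value_out Sq nq).
    case: (step _ Sp) (step _ Sr) => [p_lt|[p0 np]] [r_lt|[r0 nr]].
    * by rewrite gt_max !lt_max p_lt r_lt orbT.
    * by rewrite r0 gt_max !lt_max p_lt (le_lt_trans (ozero_le _) p_lt).
    * by rewrite p0 gt_max !lt_max r_lt (le_lt_trans (ozero_le _) r_lt) !orbT.
    * by case: tn.
- split=> [eta|eta x px|eta x px]; first by left.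
    rewrite maxE; last by left; apply: rho_tree Sp _ _ px.
    by rewrite (value_rho px) max_l // le_rho_p.
  right; exists (Order.max (value p eta) (value r eta)).
    by rewrite maxE; last by left; apply: rhobar_tree Sp _ _ px.
  by rewrite le_max (value_rhobar Sp px) lexx.
- split=> [eta|eta x rx|eta x rx]; first by right.
    rewrite maxE; last by right; apply: rho_tree Sr _ _ rx.
    by rewrite (value_rho rx) max_r // le_rho_r.
  right; exists (Order.max (value p eta) (value r eta)).
    by rewrite maxE; last by right; apply: rhobar_tree Sr _ _ rx.
  by rewrite le_max (value_rhobar Sr rx) lexx orbT.
Qed.

End Projection.

(** * The rank function property *)

Lemma pi_proj_reduct k a (p : forcing_S k a) b : regular_uncountable k ->
  rank_reduct (@stronger_S k a) (@crk_S k a) (fun b => b +o k) p b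
    (exist _ _ (pi_proj_in_S p b)).
Proof.
move=> rk; split.
- exists p; split; first exact: extends_pi_proj.
  by split=> // eta x px; left; exists x.
- exact: crk_pi_proj.
- move=> r rb [s [sr sp]].
  have [Su up ur] := max_union_in_S_extends rb sr sp.
  by exists (exist _ _ Su).
Qed.

Theorem theorem8p4 (kappa alpha : Ord)
    (kappa_regular : regular_uncountable kappa)
    (alpha_le : alpha <= card_succ kappa) :
  [/\ rank_function (@stronger_S kappa alpha) (@crk_S kappa alpha),
      {homo (fun beta => beta +o kappa) : x y / x <= y},
      rank_witness (@stronger_S kappa alpha) (@crk_S kappa alpha)
        (fun beta => beta +o kappa) &
      forall beta : Ord, beta < alpha -> forall p : forcing_S kappa alpha,
        exists q : forcing_S kappa alpha,
          triple_of q = pi_proj p beta /\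
          rank_reduct (@stronger_S kappa alpha) (@crk_S kappa alpha)
            (fun b => b +o kappa) p beta q].
Proof.
split.
- (* [beta |-> beta +o kappa] is not strictly increasing, but ranks never exceed
     [alpha], so any strictly increasing function above [alpha] will do. *)
  exists (oadd (osucc alpha)); split=> [x y|p b]; first exact: ltr_oadd.
  have [qp _ qr] := pi_proj_reduct p b kappa_regular.
  exists (exist _ _ (pi_proj_in_S p b)); split=> //=.
  apply: lt_le_trans (le_oadd _ _); apply: le_lt_trans (lt_osucc _).
  by apply: (crk_le (pi_proj_in_S p b)) => eta te;
    apply/ltW/(value_lt (pi_proj_in_S p b)).
- by move=> x y; apply: lel_oadd.
- move=> p b; exists (exist _ _ (pi_proj_in_S p b)).
  exact: pi_proj_reduct.
- move=> b _ p; exists (exist _ _ (pi_proj_in_S p b)); split=> //.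
  exact: pi_proj_reduct.
Qed.
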